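(* Let $\Gamma$ be a finitely generated group. If $\Gamma$ is sharply MIF, then $\Gamma$ is linearly MIF.
   Context: For a group $\Gamma$, a mixed word is an element $w(x)$ of the free product $\Gamma*\langle x\rangle$ of $\Gamma$ with the infinite cyclic group $\langle x\rangle$; it is nontrivial if it is not the identity of $\Gamma*\langle x\rangle$. For $\gamma\in\Gamma$, $w(\gamma)\in\Gamma$ is the result of substituting $\gamma$ for $x$. The group $\Gamma$ is mixed identity free (MIF) if for every $w\in(\Gamma*\langle x\rangle)\smallsetminus\{1\}$ there is $\gamma\in\Gamma$ with $w(\gamma)\neq 1$. Suppose $\Gamma$ is generated by a finite set $X$. For $\gamma\in\Gamma$, $\|\gamma\|_X$ is the word length with respect to $X$, and for $w\in\Gamma*\langle x\rangle$, $\|w\|_{X\cup\{x,x^{-1}\}}$ is the word length with respect to $X\cup\{x,x^{-1}\}$ (generators and their inverses are allowed as letters). Define $$f_X(w):=\min\{\|\gamma\|_X : w(\gamma)\neq 1\}\quad (w\ne 1),$$ $$f_X(n):=\max\{f_X(w): w\neq 1,\ \|w\|_{X\cup\{x,x^{-1}\}}\le n\},$$ $$\phi_X(n):=\min\{\|\gamma\|_X: w(\gamma)\neq 1\ \text{ for all } w\neq 1 \text{ with } \|w\|_{X\cup\{x,x^{-1}\}}\le n\}.$$ A finitely generated group $\Gamma=\langle X\rangle$ ($X$ finite) is sharply MIF if it is MIF and there is a constant $C=C(X)$ with $f_X(n)\le C\log(n)$ for every integer $n\ge 2$. It is linearly MIF if it is MIF and there is a constant $C=C(X)$ with $\phi_X(n)\le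 Cn$ for every integer $n\ge 1$. These properties do not depend on the choice of the finite generating set $X$. *)

(* Defs.v *)
From HB Require Import structures.
From mathcomp Require Import all_boot all_order all_algebra.
From mathcomp Require Import generic_quotient.
From mathcomp Require Import all_classical all_reals all_analysis.
Set Implicit Arguments.
Unset Strict Implicit.
Unset Printing Implicit Defensive.
Import Order.TTheory GRing.Theory Num.Theory.

Local Open Scope quotient_scope.
Local Open Scope classical_set_scope.
Local Open Scope group_scope.

(* Groups are MathComp's [groupType]s: possibly infinite groups, whose carrier
   has a choice operator (classically, no restriction). *)

(** * The free product of a group with an infinite cyclic group *)

(* [mixed G] is the free product of [G] and the infinite cyclic group <x>, given
   by its monoid presentation: finite words over [G] and the two letters x, x^-1,
   modulo the multiplication table of [G] and the cancellation of x with x^-1. *)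

(* [inl g] is g, [inr false] is x and [inr true] is x^-1. *)
Definition letter (G : groupType) : choiceType := (G + bool)%type.

Inductive mixed_eqv (G : groupType) : seq (letter G) -> seq (letter G) -> Prop :=
| mixed_eqv_mul (g h : G) : mixed_eqv [:: inl g; inl h] [:: inl (g * h)]
| mixed_eqv_one : mixed_eqv [:: inl 1] [::]
| mixed_eqv_var (b : bool) : mixed_eqv [:: inr b; inr (~~ b)] [::]
| mixed_eqv_refl u : mixed_eqv u u
| mixed_eqv_sym u v : mixed_eqv u v -> mixed_eqv v u
| mixed_eqv_trans v u w : mixed_eqv u v -> mixed_eqv v w -> mixed_eqv u w
| mixed_eqv_cat u u' v v' :
    mixed_eqv u u' -> mixed_eqv v v' -> mixed_eqv (u ++ v) (u' ++ v').

Definition mixed_eqvb (G : groupType) : rel (seq (letter G)) :=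
  fun u v => `[< mixed_eqv u v >].

Lemma mixed_eqvb_refl (G : groupType) : reflexive (@mixed_eqvb G).
Proof. by move=> u; apply/asboolP; exact: mixed_eqv_refl. Qed.

Lemma mixed_eqvb_sym (G : groupType) : symmetric (@mixed_eqvb G).
Proof. by move=> u v; apply/asboolP/asboolP; exact: mixed_eqv_sym. Qed.

Lemma mixed_eqvb_trans (G : groupType) : transitive (@mixed_eqvb G).
Proof.
by move=> v u w /asboolP uv /asboolP vw; apply/asboolP/(mixed_eqv_trans uv vw).
Qed.

Canonical mixed_equiv (G : groupType) : equiv_rel (seq (letter G)) :=
  EquivRel (@mixed_eqvb G) (@mixed_eqvb_refl G) (@mixed_eqvb_sym G)
    (@mixed_eqvb_trans G).

Definition mixed (G : groupType) : Type := {eq_quot (mixed_equiv G)}.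

HB.instance Definition _ (G : groupType) := Choice.on (mixed G).
HB.instance Definition _ (G : groupType) : Quotient _ (mixed G) :=
  Quotient.on (mixed G).
HB.instance Definition _ (G : groupType) :
    EqQuotient (seq (letter G)) (mixed_equiv G) (mixed G) :=
  EqQuotient.on (mixed G).

Definition mixed_of_word (G : groupType) (u : seq (letter G)) : mixed G :=
  \pi_(mixed G)%qT u.

Lemma mixed_of_wordP (G : groupType) (u v : seq (letter G)) :
  mixed_of_word u = mixed_of_word v <-> mixed_eqv u v.
Proof.
split=> [/eqP|uv]; first by rewrite /mixed_of_word eqmodE => /asboolP.
by apply/eqP; rewrite /mixed_of_word eqmodE; apply/asboolP.
Qed.

Lemma mixed_of_wordK (G : groupType) (w : mixed G) :
  mixed_of_word (repr w) = w.
Proof. exact: reprK. Qed.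

Definition letter_inv (G : groupType) (l : letter G) : letter G :=
  match l with inl g => inl g^-1 | inr b => inr (~~ b) end.

Definition word_inv (G : groupType) (u : seq (letter G)) : seq (letter G) :=
  rev (map (@letter_inv G) u).

Definition mixed_one (G : groupType) : mixed G := mixed_of_word [::].
Definition mixed_mul (G : groupType) (v w : mixed G) : mixed G :=
  mixed_of_word (repr v ++ repr w).
Definition mixed_inv (G : groupType) (w : mixed G) : mixed G :=
  mixed_of_word (word_inv (repr w)).

Lemma mixed_eqv_repr (G : groupType) (u : seq (letter G)) :
  mixed_eqv (repr (mixed_of_word u)) u.
Proof. by apply/mixed_of_wordP; rewrite mixed_of_wordK. Qed.

Lemma mixed_mul_word (G : groupType) (u v : seq (letter G)) :
  mixed_mul (mixed_of_word u) (mixed_of_word v) = mixed_of_word (u ++ v).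
Proof. by apply/mixed_of_wordP/mixed_eqv_cat; exact: mixed_eqv_repr. Qed.

Lemma mixed_mulA (G : groupType) : associative (@mixed_mul G).
Proof.
move=> a b c; rewrite -[a]mixed_of_wordK -[b]mixed_of_wordK.
by rewrite -[c]mixed_of_wordK !mixed_mul_word catA.
Qed.

Lemma mixed_mul1w (G : groupType) : left_id (@mixed_one G) (@mixed_mul G).
Proof. by move=> a; rewrite -[a]mixed_of_wordK mixed_mul_word. Qed.

Lemma mixed_mulw1 (G : groupType) : right_id (@mixed_one G) (@mixed_mul G).
Proof. by move=> a; rewrite -[a]mixed_of_wordK mixed_mul_word cats0. Qed.

Lemma mixed_eqv_letterV (G : groupType) (l : letter G) :
  mixed_eqv [:: l; letter_inv l] [::].
Proof.
case: l => [g|b] /=; last exact: mixed_eqv_var.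
apply: mixed_eqv_trans (mixed_eqv_mul _ _) _; rewrite mulgV.
exact: mixed_eqv_one.
Qed.

Lemma letter_invK (G : groupType) : involutive (@letter_inv G).
Proof. by case=> [g|b] /=; rewrite ?invgK ?negbK. Qed.

Lemma word_invK (G : groupType) : involutive (@word_inv G).
Proof.
by move=> u; rewrite /word_inv map_rev revK -map_comp map_id_in // => l _;
  rewrite /= letter_invK.
Qed.

Lemma mixed_eqv_wordV (G : groupType) (u : seq (letter G)) :
  mixed_eqv (u ++ word_inv u) [::].
Proof.
elim: u => [|l u IHu]; first exact: mixed_eqv_refl.
have -> : (l :: u) ++ word_inv (l :: u) =
    [:: l] ++ ((u ++ word_inv u) ++ [:: letter_inv l]).
  by rewrite /word_inv /= rev_cons -cats1 -!catA.
apply: mixed_eqv_trans (mixed_eqv_letterV l).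
apply: (mixed_eqv_cat (mixed_eqv_refl [:: l])).
exact: (mixed_eqv_cat IHu (mixed_eqv_refl [:: letter_inv l])).
Qed.

Lemma mixed_mulwV (G : groupType) :
  right_inverse (@mixed_one G) (@mixed_inv G) (@mixed_mul G).
Proof.
move=> a; rewrite -{1}[a]mixed_of_wordK mixed_mul_word.
by apply/mixed_of_wordP/mixed_eqv_wordV.
Qed.

Lemma mixed_mulVw (G : groupType) :
  left_inverse (@mixed_one G) (@mixed_inv G) (@mixed_mul G).
Proof.
move=> a; rewrite -{2}[a]mixed_of_wordK mixed_mul_word.
by apply/mixed_of_wordP; rewrite -{2}[repr a]word_invK; exact: mixed_eqv_wordV.
Qed.

HB.instance Definition _ (G : groupType) :=
  isGroup.Build (mixed G) (@mixed_mulA G) (@mixed_mul1w G) (@mixed_mulw1 G)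
    (@mixed_mulVw G) (@mixed_mulwV G).

Definition mixed_const (G : groupType) (g : G) : mixed G :=
  mixed_of_word [:: inl g].
Definition mixed_var (G : groupType) : mixed G := mixed_of_word [:: inr false].

Lemma mixed_constM (G : groupType) : {morph @mixed_const G : g h / g * h}.
Proof.
move=> g h; rewrite /mixed_const [RHS]mixed_mul_word.
by apply/mixed_of_wordP/mixed_eqv_sym/mixed_eqv_mul.
Qed.

Lemma mixed_varV (G : groupType) :
  (mixed_var G)^-1 = mixed_of_word [:: inr true].
Proof.
apply: (mulgI (mixed_var G)); rewrite mulgV [RHS]mixed_mul_word.
by apply/mixed_of_wordP/mixed_eqv_sym/(mixed_eqv_var G false).
Qed.

(** * Substitution *)

Definition letter_eval (G : groupType) (c : G) (l : letter G) : G :=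
  match l with inl g => g | inr b => if b then c^-1 else c end.

Definition word_eval (G : groupType) (c : G) (u : seq (letter G)) : G :=
  \prod_(l <- u) letter_eval c l.

(* The value w(c); by [mixed_eval_word] it does not depend on the word chosen
   to represent w. *)
Definition mixed_eval (G : groupType) (w : mixed G) (c : G) : G :=
  word_eval c (repr w).

Lemma word_eval_eqv (G : groupType) (c : G) (u v : seq (letter G)) :
  mixed_eqv u v -> word_eval c u = word_eval c v.
Proof.
rewrite /word_eval; elim=> {u v}.
- by move=> g h; rewrite !big_cons !big_nil /= !mulg1.
- by rewrite big_seq1 big_nil.
- by case; rewrite !big_cons !big_nil /= mulg1 (mulVg, mulgV).
- by [].
- by move=> u v _ ->.
- by move=> v u w _ -> _ ->.
- by move=> u u' v v' _ e _ e'; rewrite !big_cat /= e e'.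
Qed.

Lemma mixed_eval_word (G : groupType) (u : seq (letter G)) (c : G) :
  mixed_eval (mixed_of_word u) c = word_eval c u.
Proof. exact/word_eval_eqv/mixed_eqv_repr. Qed.

Lemma mixed_evalM (G : groupType) (v w : mixed G) (c : G) :
  mixed_eval (v * w) c = mixed_eval v c * mixed_eval w c.
Proof.
rewrite -[v]mixed_of_wordK -[w]mixed_of_wordK [_ * _]mixed_mul_word.
by rewrite !mixed_eval_word /word_eval big_cat.
Qed.

Lemma mixed_eval_const (G : groupType) (g c : G) :
  mixed_eval (mixed_const g) c = g.
Proof. by rewrite mixed_eval_word /word_eval big_seq1. Qed.

Lemma mixed_eval_var (G : groupType) (c : G) : mixed_eval (mixed_var G) c = c.
Proof. by rewrite mixed_eval_word /word_eval big_seq1. Qed.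

Definition MIF (G : groupType) : Prop :=
  forall w : mixed G, w <> 1 -> exists c : G, mixed_eval w c <> 1.

(** * Word length *)

Definition word_over (G : groupType) (S : set G) (s : seq G) : Prop :=
  forall a, a \in s -> S a \/ S a^-1.

Definition generates (G : groupType) (S : set G) : Prop :=
  forall g : G, exists2 s, word_over S s & \prod_(a <- s) a = g.

Definition word_lengths (G : groupType) (S : set G) (g : G) : set nat :=
  [set size s | s in [set s | word_over S s /\ \prod_(a <- s) a = g]].

(* The word length takes its values in the extended reals: it is a natural
   number on the subgroup generated by [S] and +oo elsewhere. In the same way,
   the extrema defining [fX] and [phiX] below make sense without assuming that
   the sets they range over are nonempty; an infimum of word lengths is a
   minimum as soon as it ranges over a nonempty set
   ([ereal_inf_word_length]). *)
Definition word_length (R : realType) (G : groupType) (S : set G) (g : G)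
  : \bar R := ereal_inf [set (n%:R)%:E | n in word_lengths S g].

Lemma ereal_inf_natr (R : realType) (A : set nat) : A !=set0 ->
  exists2 n, A n &
    (forall m, A m -> (n <= m)%N) /\
    ereal_inf [set (m%:R)%:E | m in A] = (n%:R)%:E :> \bar R.
Proof.
move=> [k Ak]; have exA : exists n, `[< A n >] by exists k; apply/asboolP.
case: (ex_minnP exA) => n /asboolP An nmin; exists n => //.
have {}nmin m : A m -> (n <= m)%N by move=> Am; apply/nmin/asboolP.
split=> //; apply/eqP; rewrite eq_le; apply/andP; split.
  by apply: ereal_inf_lbound; exists n.
by apply: le_ereal_inf_tmp => _ [m Am <-]; rewrite lee_fin ler_nat nmin.
Qed.

Lemma word_length_min (R : realType) (G : groupType) (S : set G) (g : G) :
  generates S ->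
  exists2 n, word_lengths S g n &
    (forall m, word_lengths S g m -> (n <= m)%N) /\
    word_length R S g = (n%:R)%:E.
Proof.
by move=> genS; apply: ereal_inf_natr; have [s Ss sg] := genS g;
  exists (size s), s.
Qed.

Lemma ereal_inf_word_length (R : realType) (G : groupType) (S A : set G) :
  generates S -> A !=set0 ->
  exists2 g, A g & ereal_inf [set word_length R S c | c in A] = word_length R S g.
Proof.
move=> genS [c Ac].
pose N := [set n | exists2 g, A g & word_length R S g = (n%:R)%:E].
have lenN g : A g -> exists2 n, N n & word_length R S g = (n%:R)%:E.
  by move=> Ag; have [n _ [_ gn]] := word_length_min R g genS;
    exists n => //; exists g.
have [|n [g Ag gn] [_ nE]] := @ereal_inf_natr R N.
  by have [n Nn _] := lenN c Ac; exists n.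
exists g => //; rewrite gn -nE; congr ereal_inf; apply/seteqP; split.
  by move=> _ [h Ah <-]; have [m Nm ->] := lenN h Ah; exists m.
by move=> _ [m [h Ah hm] <-]; exists h.
Qed.

(** * Sharply and linearly MIF groups *)

Definition mixed_gens (G : groupType) (X : set G) : set (mixed G) :=
  @mixed_const G @` X `|` [set mixed_var G; (mixed_var G)^-1].

Definition mixed_length (R : realType) (G : groupType) (X : set G)
  (w : mixed G) : \bar R := word_length R (mixed_gens X) w.

Definition punctured_ball (R : realType) (G : groupType) (X : set G) (n : nat)
  : set (mixed G) :=
  [set w | w <> 1 /\ (mixed_length R X w <= (n%:R)%:E)%E].

Definition fX_word (R : realType) (G : groupType) (X : set G) (w : mixed G)
  : \bar R :=
  ereal_inf [set word_length R X c | c in [set c | mixed_eval w c <> 1]].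

(* For finite [X] the supremum ranges over a finite set. *)
Definition fX (R : realType) (G : groupType) (X : set G) (n : nat) : \bar R :=
  ereal_sup [set fX_word R X w | w in punctured_ball R X n].

Definition phiX (R : realType) (G : groupType) (X : set G) (n : nat) : \bar R :=
  ereal_inf [set word_length R X c | c in
    [set c | forall w, punctured_ball R X n w -> mixed_eval w c <> 1]].

Definition sharply_MIF (R : realType) (G : groupType) (X : set G) : Prop :=
  MIF G /\ exists C : R, forall n : nat, (2 <= n)%N ->
    (fX R X n <= (C * ln n%:R)%R%:E)%E.

Definition linearly_MIF (R : realType) (G : groupType) (X : set G) : Prop :=
  MIF G /\ exists C : R, forall n : nat, (1 <= n)%N ->
    (phiX R X n <= (C * n%:R)%R%:E)%E.

(* Main.v *)
Require Import Defs.
From mathcomp Require Import zify.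
From mathcomp Require Import all_boot all_order all_algebra.
From mathcomp Require Import all_classical all_reals all_analysis.

(** Why a sharply MIF group is linearly MIF. The ball of radius [n] in the
    group of mixed words has at most [2 ^ (B * n)] elements, for a constant [B]
    that depends on [X] only ([word_ball_card]). All its nontrivial elements are
    folded into a single mixed word [W], a balanced binary tree of commutators
    with these elements at the leaves. Substituting [c] in a commutator gives 1
    as soon as it gives 1 in one of the two arguments, hence [W(c) <> 1] forces
    [w(c) <> 1] for every [w <> 1] in the ball, and [phiX n] is at most the
    value of [fX] at the length of [W]. Each of the [B * n] levels of the tree
    multiplies lengths by 4, up to an additive constant, so [W] has length at
    most [2 ^ (M * n)] for some constant [M] ([commutator_tree]). The
    logarithmic bound on [fX] then becomes a linear bound in [n].

    The difficulty is to keep [W] nontrivial: two nontrivial mixed words may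
    commute. Before taking the commutator of [u] and [v], one conjugates them
    by short words, so that the conjugate of [u] has a reduced form
    [x ... x^-1] and that of [v] has a reduced form [x^-1 ... x]; two such
    elements play ping-pong and do not commute ([noncommuting_conjugates]). The
    conjugators are [x g] and [x^-1 h], where [g] and [h] are chosen among
    three fixed elements of the group so as to avoid the at most two values
    that produce cancellation. Three such elements are [1], [c] and [c^-1] with
    [c * c <> 1], and [c] exists since the mixed word [x * x] is not an
    identity. *)

Set Implicit Arguments.
Unset Strict Implicit.
Unset Printing Implicit Defensive.

Import Order.TTheory GRing.Theory Num.Theory.

Local Open Scope classical_set_scope.
Local Open Scope group_scope.

(** * Reduced forms of mixed words *)

(** The pair [(g, [:: (e1, g1); ...; (em, gm)])] stands for the word
    [g x^e1 g1 ... x^em gm], where a boolean [e] encodes the exponent [1] when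
    it is [false] and [-1] when it is [true], as in [letter]. *)
Definition nform (G : groupType) : Type := (G * seq (bool * G))%type.

Definition reduced (G : groupType) (st : nform G) : bool :=
  sorted (fun p q : bool * G => (p.2 == 1) ==> (p.1 == q.1)) st.2.

Definition nform_word (G : groupType) (st : nform G) : seq (letter G) :=
  inl st.1 :: flatten [seq [:: inr p.1; inl p.2] | p <- st.2].

(** Left multiplication of a reduced form by a letter, followed by the only
    reduction that this can make possible. Letting words act in this way is van
    der Waerden's method: relations between words need only be checked on
    reduced forms, and no confluence argument is required. *)
Definition letter_act (G : groupType) (l : letter G) (st : nform G) : nform G :=
  match l with
  | inl a => (a * st.1, st.2)
  | inr b =>
    if st.2 is (e, h) :: s then
      if (st.1 == 1) && (e != b) then (h, s) else (1, (b, st.1) :: st.2)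
    else (1, [:: (b, st.1)])
  end.

Definition word_act (G : groupType) (u : seq (letter G)) (st : nform G) :=
  foldr (@letter_act G) st u.

Lemma word_act_reduced (G : groupType) (u : seq (letter G)) (st : nform G) :
  reduced st -> reduced (word_act u st).
Proof.
elim: u => //= l u IHu /IHu {IHu}; case: (word_act u st) => g s.
case: l => [a|b] //; case: s => [|[e h] s] //= red.
have [_|/=] := boolP ((g == 1) && (e != b)); first exact: path_sorted red.
rewrite negb_and negbK => gb; apply/andP; split; last exact: red.
by rewrite implybE /= [b == e]eq_sym.
Qed.

(** Reducedness matters here: on a form starting with a cancelling pair
    [x^b 1 x^-b], the letter [x^-b] would remove [x^b], and the letter [x^b]
    would then remove [x^-b] instead of restoring the form. *)
Lemma word_act_cancel (G : groupType) (b : bool) (st : nform G) :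
  reduced st -> word_act [:: inr b; inr (~~ b)] st = st.
Proof.
case: st => g [|[e h] s] red /=; first by rewrite eqxx; case: (b).
have [/andP[/eqP -> eb]|/=] := boolP ((g == 1) && (e != ~~ b)); last first.
  by rewrite eqxx; case: (b).
have {eb} e_b : e = b by move: eb; case: (e) (b) => [] [].
rewrite {e}e_b /= in red *.
case: s red => [|[f k] s] //= /andP[/= hf _].
by case: (h == 1) hf => //= /eqP <-; case: (b).
Qed.

Lemma word_act_eqv (G : groupType) (u v : seq (letter G)) (st : nform G) :
  mixed_eqv u v -> reduced st -> word_act u st = word_act v st.
Proof.
move=> uv; elim: uv st => {u v}.
- by move=> g h [k s] _ /=; rewrite mulgA.
- by move=> [k s] _ /=; rewrite mul1g.
- by move=> b st /word_act_cancel.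
- by [].
- by move=> u v _ IH st /IH.
- by move=> v u w _ IH _ IH' st red; rewrite IH ?IH'.
- move=> u u' v v' _ IH _ IH' st red; rewrite /word_act !foldr_cat -!/(word_act _ _).
  by rewrite IH' ?IH ?word_act_reduced.
Qed.

Definition mixed_act (G : groupType) (w : mixed G) (st : nform G) : nform G :=
  word_act (repr w) st.

Lemma mixed_act_word (G : groupType) (u : seq (letter G)) (st : nform G) :
  reduced st -> mixed_act (mixed_of_word u) st = word_act u st.
Proof. exact: word_act_eqv (mixed_eqv_repr u). Qed.

Lemma mixed_act_reduced (G : groupType) (w : mixed G) (st : nform G) :
  reduced st -> reduced (mixed_act w st).
Proof. exact: word_act_reduced. Qed.

Lemma mixed_actM (G : groupType) (v w : mixed G) (st : nform G) :
  reduced st -> mixed_act (v * w) st = mixed_act v (mixed_act w st).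
Proof. by move=> red; rewrite mixed_act_word // /word_act foldr_cat. Qed.

Lemma letter_act_word (G : groupType) (l : letter G) (st : nform G) :
  mixed_eqv (l :: nform_word st) (nform_word (letter_act l st)).
Proof.
have expand b (g : G) r :
    mixed_eqv [:: inr b, inl g & r] [:: inl 1, inr b, inl g & r].
  apply: (@mixed_eqv_cat _ [::] [:: inl 1] _ _ _ (mixed_eqv_refl _)).
  exact/mixed_eqv_sym/mixed_eqv_one.
case: st l => g s [a|b] /=.
  exact: (@mixed_eqv_cat _ [:: _; _] [:: _] _ _ (mixed_eqv_mul a g)
            (mixed_eqv_refl _)).
case: s => [|[e h] s]; first exact: expand.
case: ifP => [/andP[/eqP -> eb]|_]; last exact: expand.
have -> : e = ~~ b by move: eb; case: (e) (b) => [] [].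
rewrite /nform_word /=.
apply: (@mixed_eqv_trans _ ([:: inr b; inr (~~ b)] ++
    inl h :: flatten [seq [:: inr p.1; inl p.2] | p <- s])).
  apply: (@mixed_eqv_cat _ [:: _] [:: _] _ _ (mixed_eqv_refl _)).
  exact: (@mixed_eqv_cat _ [:: _] [::] _ _ (mixed_eqv_one G)
            (mixed_eqv_refl _)).
exact: (@mixed_eqv_cat _ _ [::] _ _ (mixed_eqv_var G b) (mixed_eqv_refl _)).
Qed.

(** The reduced form of [w] is the image under [w] of the empty one. *)
Lemma exists_nform (G : groupType) (w : mixed G) :
  exists2 st, reduced st & mixed_of_word (nform_word st) = w.
Proof.
exists (mixed_act w (1, [::])); first exact: mixed_act_reduced.
rewrite -[RHS]mixed_of_wordK /mixed_act; apply/mixed_of_wordP.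
elim: (repr w) => [|l u IHu] /=; first exact: mixed_eqv_one.
apply: mixed_eqv_trans (mixed_eqv_sym (letter_act_word _ _)) _.
exact: (@mixed_eqv_cat _ [:: l] [:: l] _ _ (mixed_eqv_refl _) IHu).
Qed.

(** * Ping-pong *)

Definition starts (G : groupType) (b : bool) (st : nform G) : bool :=
  (st.1 == 1) && (if st.2 is p :: _ then p.1 == b else false).

Lemma letter_act_starts (G : groupType) (b : bool) (st : nform G) :
  ~~ starts (~~ b) st -> letter_act (inr b) st = (1, (b, st.1) :: st.2).
Proof.
case: st => g [|[e h] s] //=; rewrite /starts /=.
by case: ifP => // /andP[-> /=]; case: (e) (b) => [] [].
Qed.

(** Concatenating two reduced forms creates no cancellation when the elements of
    [G] that meet at the junction have a nontrivial product; the beginning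
    [g x^b] of the first form is then left unchanged. *)
Lemma word_act_concat (G : groupType) (g h : G) (b : bool) (s : seq (bool * G))
    (st : nform G) :
  reduced (g, (b, h) :: s) -> (last (b, h) s).2 * st.1 != 1 ->
  exists k r, word_act (nform_word (g, (b, h) :: s)) st = (g, (b, k) :: r).
Proof.
have unfold (f k : G) c r : word_act (nform_word (f, (c, k) :: r)) st =
  letter_act (inl f) (letter_act (inr c) (word_act (nform_word (k, r)) st)).
  by [].
elim: s g b h => [|[e k] s IHs] g b h red ne; rewrite unfold.
  rewrite letter_act_starts /=; last by rewrite /starts negb_and ne.
  by rewrite mulg1; exists (h * st.1), st.2.
have /andP[hb red_s] : ((h == 1) ==> (b == e)) && reduced (h, (e, k) :: s).
  exact: red.
have [k' [r ->]] := IHs h e k red_s ne.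
rewrite letter_act_starts /=; first by rewrite mulg1; do 2!eexists.
by move: hb; rewrite /starts /=; case: (h == 1) => //= /eqP ->; case: (e).
Qed.

Definition mixed_letter (G : groupType) (b : bool) : mixed G :=
  mixed_of_word [:: inr b].

Lemma exists_avoiding2 (T : eqType) (s : seq T) (a b : T) :
  uniq s -> (2 < size s)%N -> exists2 c, c \in s & (c != a) && (c != b).
Proof.
move=> us s2; apply/hasP; apply: contraLR s2 => /hasPn sub.
rewrite -leqNgt; apply: (@uniq_leq_size _ _ [:: a; b]) => // c /sub.
by rewrite negb_and !negbK !inE.
Qed.

Lemma conj_mixed_letter (G : groupType) (b : bool) (g : G)
    (u : seq (letter G)) :
  mixed_of_word u ^ (mixed_letter G b * mixed_const g)^-1 =
  mixed_of_word ([:: inr b; inl g] ++ u ++ [:: inl g^-1; inr (~~ b)]).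
Proof.
have tE : mixed_letter G b * mixed_const g = mixed_of_word [:: inr b; inl g].
  exact: mixed_mul_word.
have tV : (mixed_letter G b * mixed_const g)^-1 =
    mixed_of_word [:: inl g^-1; inr (~~ b)].
  apply: (mulgI (mixed_letter G b * mixed_const g)); rewrite mulgV tE.
  rewrite [RHS]mixed_mul_word; apply/mixed_of_wordP/mixed_eqv_sym.
  exact: (mixed_eqv_wordV [:: inr b; inl g]).
rewrite conjgE invgK tV tE [mixed_of_word u * _]mixed_mul_word.
exact: mixed_mul_word.
Qed.

(** Let [g0] and [gm] be the first and the last coefficient of the reduced form
    of [u]. In [x g u g^-1 x^-1], nothing cancels before [g0] if
    [g <> g0^-1], and nothing cancels after [gm] if [g <> gm]; when [u] is an
    element of [G], its conjugate by [g] is nontrivial for every [g]. A single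
    [g] works for both signs [b] of the exponent of [x]. *)
Lemma ping_pong_conjugate (G : groupType) (T : seq G) (u : mixed G) :
    uniq T -> (2 < size T)%N -> u <> 1 ->
  exists2 g, g \in T & forall b st, reduced st -> ~~ starts b st ->
    starts b (mixed_act (u ^ (mixed_letter G b * mixed_const g)^-1) st).
Proof.
move=> uT T2 u1; have [[g0 s] red eu] := exists_nform u.
have [g gT /andP[g_g0 g_gm]] :=
  exists_avoiding2 g0^-1 (last (true, 1) s).2 uT T2.
exists g => // b st red_st st_b.
rewrite -eu conj_mixed_letter mixed_act_word // /word_act !foldr_cat.
rewrite -!/(word_act _ _).
set st' := word_act [:: inl g^-1; _] st.
have st'E : st' = (g^-1, (~~ b, st.1) :: st.2).
  transitivity (letter_act (inl g^-1) (letter_act (inr (~~ b)) st)) => //.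
  by rewrite letter_act_starts ?negbK //= mulg1.
have -> y : word_act [:: inr b; inl g] y = letter_act (inr b) (g * y.1, y.2).
  by [].
rewrite letter_act_starts; first by rewrite /starts /= !eqxx.
case: s red eu g_gm => [|[e h] s] red eu g_gm.
  rewrite st'E /starts negb_and /= mulgA mulg_eq1 invgK -[X in _ == X]mulg1.
  rewrite (inj_eq (mulgI g)); apply/orP; left; apply/eqP => g01.
  by apply: u1; rewrite -eu g01; apply/mixed_of_wordP/mixed_eqv_one.
have [k [r ->]] : exists k r,
    word_act (nform_word (g0, (e, h) :: s)) st' = (g0, (e, k) :: r).
  by apply: word_act_concat => //; rewrite st'E /= divg_eq1 eq_sym.
by rewrite /starts /= negb_and mulg_eq1 g_g0.
Qed.

(** Let [U] and [V] be the two conjugates. [U] sends every reduced form that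
    does not start with [x] to one that does, and [V] does the same with
    [x^-1]. Applied to the empty form, [U * V] thus gives a form that starts
    with [x] and [V * U] one that starts with [x^-1]. *)
Lemma noncommuting_conjugates (G : groupType) (T : seq G) (u v : mixed G) :
    uniq T -> (2 < size T)%N -> u <> 1 -> v <> 1 ->
  exists g h, [/\ g \in T, h \in T &
    [~ u ^ (mixed_letter G false * mixed_const g)^-1,
       v ^ (mixed_letter G true * mixed_const h)^-1] <> 1].
Proof.
move=> uT T2 /(ping_pong_conjugate uT T2)[g gT Hu].
move=> /(ping_pong_conjugate uT T2)[h hT Hv].
exists g, h; split=> // /eqP/commgP.
move: (_ ^ _) (_ ^ _) (Hu false) (Hv true) => V U {}Hu {}Hv UV.
pose o : nform G := (1, [::]).
have excl st : @starts G true st -> ~~ starts false st.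
  by case: st => k [|[[] k'] s]; rewrite /starts ?andbF.
have excl' st : @starts G false st -> ~~ starts true st.
  by apply: contraTN => /excl.
have o0 b : ~~ starts b o by rewrite /starts andbF.
have UVo : starts false (mixed_act (U * V) o).
  by rewrite mixed_actM // Hu ?mixed_act_reduced // excl // Hv.
move/excl'/negP: UVo; apply; rewrite UV.
by rewrite mixed_actM // Hv ?mixed_act_reduced // excl' // Hu.
Qed.

Lemma mixed_letter_sq_neq1 (G : groupType) (b : bool) :
  mixed_letter G b * mixed_letter G b <> 1.
Proof.
have actE : mixed_act (mixed_letter G b * mixed_letter G b) (1, [::]) =
    (1, [:: (b, 1); (b, 1)]).
  by rewrite [_ * _]mixed_mul_word mixed_act_word //= eqxx; case: b.
by move=> sq1; move: actE; rewrite sq1 mixed_act_word.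
Qed.

Lemma MIF_sq_neq1 (G : groupType) : MIF G -> exists c : G, c * c <> 1.
Proof.
move=> /(_ _ (@mixed_letter_sq_neq1 G false))[c].
by rewrite mixed_evalM mixed_eval_var => ?; exists c.
Qed.

(** * Word lengths *)

Definition word_ball (G : groupType) (S : set G) (n : nat) : set G :=
  [set g | exists2 s, word_over S s & \prod_(a <- s) a = g /\ (size s <= n)%N].

(** Bounding the length by a natural number amounts to exhibiting a short word:
    the infimum that defines the length is attained when it is finite. *)
Lemma word_length_leP (R : realType) (G : groupType) (S : set G) (n : nat)
    (g : G) :
  (word_length R S g <= n%:R%:E)%E <-> word_ball S n g.
Proof.
split=> [|[s Ss [sg sn]]]; last first.
  apply: (@le_trans _ _ ((size s)%:R)%:E); last by rewrite lee_fin ler_nat.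
  by apply: ereal_inf_lbound; exists (size s) => //; exists s.
have [len0|/set0P lenN0] := eqVneq (word_lengths S g) set0.
  by rewrite /word_length len0 image_set0 ereal_inf0 leye_eq.
have [_ [s [Ss sg] <-] [_]] := ereal_inf_natr R lenN0.
by rewrite /word_length => ->; rewrite lee_fin ler_nat; exists s.
Qed.

Lemma word_ball_le (G : groupType) (S : set G) (m n : nat) :
  (m <= n)%N -> word_ball S m `<=` word_ball S n.
Proof. by move=> mn g [s Ss [sg sm]]; exists s; rewrite ?(leq_trans sm). Qed.

Lemma word_ballM (G : groupType) (S : set G) (m n : nat) (g h : G) :
  word_ball S m g -> word_ball S n h -> word_ball S (m + n) (g * h).
Proof.
move=> [s Ss [<- sm]] [t St [<- tn]]; exists (s ++ t).
  by move=> a; rewrite mem_cat => /orP[/Ss|/St].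
by rewrite big_cat size_cat leq_add.
Qed.

Lemma word_ball1 (G : groupType) (S : set G) (a : G) :
  S a -> word_ball S 1 a.
Proof.
by move=> Sa; exists [:: a]; rewrite ?big_seq1 // => b; rewrite inE => /eqP->;
  left.
Qed.

Lemma word_ballV (G : groupType) (S : set G) (n : nat) (g : G) :
  word_ball S n g -> word_ball S n g^-1.
Proof.
move=> [s Ss [<- sn]]; exists (rev (map (fun a => a^-1) s)); last first.
  by rewrite -map_rev size_map size_rev big_map prodgV revK.
move=> a; rewrite mem_rev => /mapP[b /Ss Sb ->]; rewrite invgK.
by case: Sb; [right|left].
Qed.

Lemma word_ball_conj (G : groupType) (S : set G) (m n : nat) (g h : G) :
  word_ball S m g -> word_ball S n h -> word_ball S (n + (m + n)) (g ^ h).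
Proof.
by move=> Sg Sh; apply: word_ballM (word_ballV Sh) (word_ballM Sg Sh).
Qed.

Lemma word_ball_comm (G : groupType) (S : set G) (m n : nat) (g h : G) :
  word_ball S m g -> word_ball S n h ->
  word_ball S (m + (n + (m + n))) [~ g, h].
Proof.
by move=> Sg Sh; apply: word_ballM (word_ballV Sg) (word_ball_conj Sg Sh).
Qed.

(** Padding with the letter 1 makes all words have length exactly [n], so that
    the [n]-fold products of a fixed list of letters cover the ball. The bound
    is a power of 2 because it is compared with the number of leaves of a
    binary tree. *)
Lemma word_ball_card (G : groupType) (S : set G) : finite_set S ->
  exists B, forall n, exists2 ws : seq G,
    (size ws <= 2 ^ (B * n))%N & forall g, word_ball S n g -> g \in ws.
Proof.
move=> /finite_seqP[S' SE]; pose A := 1 :: S' ++ map (fun a => a^-1) S'.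
have AS a : S a \/ S a^-1 -> a \in A.
  rewrite inE mem_cat SE /= => -[->|aV]; first by rewrite orbT.
  by rewrite -[a]invgK map_f ?orbT.
have A1 : 1 \in A by rewrite mem_head.
clearbody A; exists (size A) => n.
exists (iter n (fun ws => [seq a * g | a <- A, g <- ws]) [:: 1]).
  have -> : size (iter n (fun ws => [seq a * g | a <- A, g <- ws]) [:: 1]) =
      (size A ^ n)%N.
    by elim: n => //= n IHn; rewrite size_allpairs IHn expnS.
  move: (size A) => q; rewrite expnM; case: n => [|n]; first by rewrite !expn0.
  by rewrite leq_exp2r // ltnW // ltn_expl.
move=> g [s Ss [<- sn]]; elim: n s Ss sn => [|n IHn] [|a s] //= Ss sn.
- by rewrite big_nil inE.
- rewrite big_nil -[X in X \in _]mulg1; apply: allpairs_f; first exact: A1.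
  by have := IHn [::] Ss isT; rewrite big_nil.
- rewrite big_cons; apply: allpairs_f; first by apply/AS/Ss; rewrite inE eqxx.
  by apply: IHn sn => b sb; apply: Ss; rewrite inE sb orbT.
Qed.

Lemma finite_mixed_gens (G : groupType) (X : set G) :
  finite_set X -> finite_set (mixed_gens X).
Proof.
move=> finX; rewrite finite_setU; split; first exact: finite_image.
exact: finite_set2.
Qed.

Lemma word_ball_mixed_letter (G : groupType) (X : set G) (b : bool) :
  word_ball (mixed_gens X) 1 (mixed_letter G b).
Proof.
apply: word_ball1; right; case: b; last by left.
by right; rewrite /= mixed_varV.
Qed.

Lemma word_ball_const (G : groupType) (X : set G) (n : nat) (g : G) :
  word_ball X n g -> word_ball (mixed_gens X) n (mixed_const g).
Proof.
have constV a : (@mixed_const G a)^-1 = mixed_const a^-1.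
  apply: (mulgI (mixed_const a)); rewrite mulgV -mixed_constM mulgV.
  exact/mixed_of_wordP/mixed_eqv_sym/mixed_eqv_one.
move=> [s Xs [<- sn]]; exists (map (@mixed_const G) s).
  move=> _ /mapP[a /Xs Xa ->]; rewrite constV.
  by case: Xa => Xa; [left|right]; left; [exists a|exists a^-1].
rewrite size_map; split=> //; elim: (s) => [|a t IHt].
  by rewrite !big_nil; apply/mixed_of_wordP/mixed_eqv_sym/mixed_eqv_one.
by rewrite /= !big_cons IHt mixed_constM.
Qed.

(** * Balanced trees of commutators *)

Lemma mixed_eval1 (G : groupType) (c : G) : mixed_eval 1 c = 1.
Proof. by rewrite mixed_eval_word /word_eval big_nil. Qed.

Lemma mixed_evalV (G : groupType) (w : mixed G) (c : G) :
  mixed_eval w^-1 c = (mixed_eval w c)^-1.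
Proof.
by apply: (mulgI (mixed_eval w c)); rewrite -mixed_evalM !mulgV mixed_eval1.
Qed.

Lemma mixed_evalJ (G : groupType) (v w : mixed G) (c : G) :
  mixed_eval (v ^ w) c = mixed_eval v c ^ mixed_eval w c.
Proof. by rewrite !mixed_evalM mixed_evalV. Qed.

Lemma mixed_evalR (G : groupType) (v w : mixed G) (c : G) :
  mixed_eval [~ v, w] c = [~ mixed_eval v c, mixed_eval w c].
Proof. by rewrite mixed_evalM mixed_evalV mixed_evalJ. Qed.

(** If [u] and [v] have length at most [L], the commutator of their conjugates by
    words of length [K.+1] has length at most [4 * L + 8 * K.+1]. Shifting by
    [8 * K.+1] turns this recursion into a geometric one, since
    [4 * L + 16 * K.+1 = 4 * (L + 8 * K.+1)]. *)
Lemma commutator_tree (G : groupType) (X : set G) (T : seq G) (K : nat)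
    (d n : nat) (ws : seq (mixed G)) :
    uniq T -> (2 < size T)%N -> (forall g, g \in T -> word_ball X K g) ->
    (0 < n)%N -> (size ws <= 2 ^ d)%N ->
    (forall w, w \in ws -> w <> 1 /\ word_ball (mixed_gens X) n w) ->
  exists W m, [/\ W <> 1, word_ball (mixed_gens X) m W,
    (m + 8 * K.+1 <= 4 ^ d * (n + 8 * K.+1))%N &
    forall c, mixed_eval W c <> 1 ->
      forall w, w \in ws -> mixed_eval w c <> 1].
Proof.
move=> uT T2 TK n_gt0; elim: d ws => [|d IHd] ws sz_ws ws_ok.
  case: ws sz_ws ws_ok => [|w [|//]] _ ws_ok.
    (* With no word to detect, any nontrivial mixed word of length at most [n]
       will do, such as [x]. *)
    exists (mixed_letter G false), n; split=> //; last by rewrite mul1n.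
      by move=> x1; apply: (@mixed_letter_sq_neq1 G false); rewrite x1 mul1g.
    exact: word_ball_le n_gt0 _ (word_ball_mixed_letter _ _).
  have [|w1 wn] := ws_ok w; first exact: mem_head.
  by exists w, n; split=> // [|c wc v]; rewrite ?mul1n // inE => /eqP ->.
have [|w w_in|U [k [U1 kU k_le Uws]]] := IHd (take (2 ^ d) ws).
- by rewrite size_take_min geq_minl.
- exact/ws_ok/(mem_take w_in).
have [|w w_in|V [l [V1 lV l_le Vws]]] := IHd (drop (2 ^ d) ws).
- by rewrite size_drop leq_subLR addnn -mul2n -expnS.
- exact/ws_ok/(mem_drop w_in).
have [g [h [gT hT]]] := noncommuting_conjugates uT T2 U1 V1.
have tK b a : a \in T ->
    word_ball (mixed_gens X) K.+1 (mixed_letter G b * mixed_const a)^-1.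
  move=> /TK /word_ball_const aK.
  exact: word_ballV (word_ballM (word_ball_mixed_letter X b) aK).
set U' := U ^ _; set V' := V ^ _ => UV1.
have UVm := word_ball_comm (word_ball_conj kU (tK false _ gT))
  (word_ball_conj lV (tK true _ hT)).
exists [~ U', V']; eexists; split; first exact: UV1.
- exact: UVm.
- rewrite expnS; lia.
- move=> c; rewrite mixed_evalR !mixed_evalJ => UVc w.
  rewrite -(cat_take_drop (2 ^ d) ws) mem_cat => /orP[]; [apply: Uws|apply: Vws].
    by move=> Uc; apply: UVc; rewrite Uc conj1g comm1g.
  by move=> Vc; apply: UVc; rewrite Vc conj1g commg1.
Qed.

(** * From logarithmic to linear growth *)

(** The mixed word [W] built from the ball of radius [n] competes in the maximum
    defining [fX], and any [c] with [W(c) <> 1] competes in the minimum defining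
    [phiX]. *)
Lemma phiX_le_fX (R : realType) (G : groupType) (X : set G) :
    MIF G -> finite_set X -> generates X ->
  exists2 M, (0 < M)%N &
    forall n, (0 < n)%N -> (phiX R X n <= fX R X (2 ^ (M * n)))%E.
Proof.
move=> mifG finX genX; have [c c2] := MIF_sq_neq1 mifG.
have [s Xs sc] := genX c.
have Xc : word_ball X (size s) c by exists s.
have [B HB] := word_ball_card (finite_mixed_gens finX).
exists ((2 * B + 8 * (size s).+1).+1) => // n n_gt0.
have [ws sz_ws wsP] := HB n.
pose good w := `[< w <> 1 /\ word_ball (mixed_gens X) n w >].
have [||||||W [m [W1 Wm m_le Wws]]] :=
  @commutator_tree G X [:: 1; c; c^-1] (size s) (B * n) n [seq w <- ws | good w].
- rewrite /= !inE negb_or eq_sym [1 == _]eq_sym invg_eq1 andbb andbT.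
  apply/andP; split; apply/eqP => e; apply: c2.
    by rewrite e mulg1.
  by rewrite [X in _ * X]e mulgV.
- by [].
- move=> g; rewrite !inE => /or3P[] /eqP -> //; last exact: word_ballV.
  by exists [::]; rewrite ?big_nil.
- exact: n_gt0.
- by rewrite size_filter (leq_trans (count_size _ _)).
- by move=> w; rewrite mem_filter => /andP[/asboolP].
apply: (@le_trans _ _ (fX_word R X W)).
  apply: ereal_inf_le_tmp => _ [g Wg <-]; exists g => //.
  move=> w [w1 /word_length_leP wn].
  by apply: Wws Wg _ _; rewrite mem_filter wsP // andbT; apply/asboolP.
apply: ereal_sup_ubound; exists W => //; split=> //; apply/word_length_leP.
apply: word_ball_le Wm.
move: (8 * _)%N m_le => E m_le.
apply: (@leq_trans (4 ^ (B * n) * (n + E))); first lia.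
have -> : ((2 * B + E).+1 * n = 2 * (B * n) + E.+1 * n)%N by lia.
rewrite expnD (expnM 2 2) leq_mul2l; apply/orP; right.
apply: (@leq_trans (2 ^ (n + E))); first by rewrite ltnW // ltn_expl.
rewrite leq_exp2l //; nia.
Qed.

Theorem proposition1p2 (R : realType) (G : groupType) (X : set G)
    (finX : finite_set X) (genX : generates X) :
  sharply_MIF R X -> linearly_MIF R X.
Proof.
move=> [mifG [C fC]]; split=> //.
have [M M_gt0 phi_f] := phiX_le_fX R mifG finX genX.
exists (C * (M%:R * ln 2))%R => n n_gt0.
apply: le_trans (phi_f n n_gt0) _; apply: le_trans (fC _ _) _.
  by rewrite -[X in (X <= _)%N]expn1 leq_exp2l // muln_gt0 M_gt0.
by rewrite lee_fin natrX lnXn // -mulrA mulrnA mulr_natl mulr_natr lexx.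
Qed.
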